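(* Let $\mathbf{Z}$ be a $z\times z$ (real or complex) matrix with $A$ different eigenvalues $\lambda_1,\dots,\lambda_A$, where $1\le A\le z$, and let $\mathcal{Z}=\{1,\dots,z\}$. Then for any $\epsilon>0$ there exist $N>0$ and $\kappa>0$ such that $$\left|[\mathbf{Z}^i]_{j,k}\right|^2<\kappa\left(\rho(\mathbf{Z})+\epsilon\right)^{2i},\qquad\forall j,k\in\mathcal{Z},\ \forall i>N .$$
   Context: $\rho(\mathbf{Z})$ is the spectral radius of $\mathbf{Z}$ and $[\mathbf{Z}^i]_{j,k}$ is the $(j,k)$ entry of the $i$th power of $\mathbf{Z}$, $i\in\mathbb{N}$. *)

(* Defs.v *)
From mathcomp Require Import all_boot all_order all_algebra.
From mathcomp Require Import classical_sets reals complex.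
Set Implicit Arguments.
Unset Strict Implicit.
Unset Printing Implicit Defensive.
Import Order.TTheory GRing.Theory Num.Theory.
Local Open Scope classical_set_scope.
Local Open Scope ring_scope.
Local Open Scope complex_scope.

(* The norm of R[i] takes its values in R[i]; [r%:C = `|a|] reads it as a real
   number.  For [0 < n] the set is finite and nonempty, so its supremum is a
   maximum; for [n = 0] it is empty and its supremum is 0. *)
Definition spectral_radius (R : realType) (n : nat) (Z : 'M[R[i]]_n) : R :=
  sup [set r : R | exists2 a : R[i], eigenvalue Z a & r%:C = `|a|].

(* Main.v *)
(* Idea: factor the characteristic polynomial as a product of [X - a].  By
   Cayley-Hamilton it annihilates Z; peeling off the factors one at a time,
   the identity [Z^(i+1) M = a Z^i M + Z^i (Z - a) M] reduces the growth bound
   for M to that of [(Z - a) M], which is annihilated by one factor less.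
   This avoids the Jordan form. *)
Require Import Defs.
From mathcomp Require Import all_boot all_order all_algebra.
From mathcomp Require Import classical_sets reals complex.
Set Implicit Arguments.
Unset Strict Implicit.
Unset Printing Implicit Defensive.
Import Order.TTheory GRing.Theory Num.Theory.
Local Open Scope ring_scope.
Local Open Scope complex_scope.

(** Because of the strict gap [r < s], the forcing term sets the growth rate. Each factor peeled off
    thus keeps the rate [s], with no polynomial factor in [i] even when roots repeat. *)
Lemma affine_recurrence_bound (F : numFieldType) (u v : nat -> F)
    (a r s C : F) :
  `|a| <= r -> r < s ->
  (forall i, u i.+1 = a * u i + v i) ->
  (forall i, `|v i| <= C * s ^+ i) ->
  exists K, forall i, `|u i| <= K * s ^+ i.
Proof.
move=> ar rs uS vC.
have r_ge0 : 0 <= r := le_trans (normr_ge0 a) ar.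
have s_gt0 : 0 < s := le_lt_trans r_ge0 rs.
have sr_gt0 : 0 < s - r by rewrite subr_gt0.
have C_ge0 : 0 <= C.
  by have := vC 0; rewrite expr0 mulr1; apply: le_trans.
(* The first summand ensures [r * K + C <= s * K], which drives the induction; the second covers
   [i = 0]. *)
exists (C / (s - r) + `|u 0|); elim=> [|i IHi].
  by rewrite expr0 mulr1 lerDr divr_ge0 // ltW.
set K := _ + _ in IHi *.
have CK : C <= (s - r) * K.
  by rewrite mulrDr mulrCA divff ?gt_eqF// mulr1 lerDl mulr_ge0 // ltW.
rewrite uS (le_trans (ler_normD _ _)) // normrM.
apply: (@le_trans _ _ (r * (K * s ^+ i) + C * s ^+ i)).
  by rewrite lerD // ler_pM.
rewrite mulrA -mulrDl exprS mulrA ler_wpM2r ?exprn_ge0 ?(ltW s_gt0)//.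
by rewrite [K * s]mulrC -lerBrDl -mulrBl.
Qed.

Lemma annihilated_power_bound (F : numFieldType) (n : nat)
    (Z : 'M[F]_n.+1) (r s : F) (roots : seq F) (M : 'M[F]_n.+1)
    (j k : 'I_n.+1) :
  r < s -> {in roots, forall a, `|a| <= r} ->
  horner_mx Z (\prod_(a <- roots) ('X - a%:P)) * M = 0 ->
  exists K, forall i, `|(Z ^+ i * M) j k| <= K * s ^+ i.
Proof.
move=> rs; elim: roots M => [|a roots IH] M roots_le.
  rewrite big_nil rmorph1 mul1r => ->; exists 0 => i.
  by rewrite mulr0 mxE normr0 mul0r.
(* Polynomial factors commute, so ['X - a%:P] can be moved last and absorbed into [M]. *)
rewrite big_cons mulrC rmorphM /= rmorphB /= horner_mx_X horner_mx_C -mulrA.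
case/IH => [b b_roots | C vC]; first by rewrite roots_le // in_cons b_roots orbT.
apply: (affine_recurrence_bound (roots_le a (mem_head _ _)) rs _ vC) => i.
have ->: Z ^+ i.+1 * M = a *: (Z ^+ i * M) + Z ^+ i * ((Z - a%:M) * M).
  rewrite mulrBl mulrBr mulrA -exprSr [_%:M * M]mul_scalar_mx -scalerAr.
  by rewrite addrC subrK.
by rewrite mxE [X in X + _]mxE.
Qed.

(** A supremum bounds its set only if the set is bounded above; here the finite list [lambda]
    supplies the bound, namely the sum of all [|lambda l|]. *)
Lemma le_spectral_radius (R : realType) (n A : nat) (Z : 'M[R[i]]_n)
    (lambda : 'I_A -> R[i]) (a : R[i]) :
  (forall b, eigenvalue Z b -> exists l, b = lambda l) ->
  eigenvalue Z a -> `|a| <= (spectral_radius Z)%:C.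
Proof.
move=> lambdaP Za.
have normE (b : R[i]) : (complex.Re `|b|)%:C = `|b|.
  by rewrite RRe_real // normr_real.
rewrite -normE lecR; apply: ub_le_sup; last by exists a.
exists (complex.Re (\sum_l `|lambda l|)) => r [b /lambdaP[l ->] rE].
rewrite -lecR RRe_real ?rE; last by apply/ger0_real/sumr_ge0.
by rewrite (bigD1 l) //= lerDl sumr_ge0.
Qed.

Theorem lemma2 (R : realType) (z A : nat) (Z : 'M[R[i]]_z)
    (lambda : 'I_A -> R[i])
    (A_ge1 : (1 <= A)%N) (A_le_z : (A <= z)%N)
    (lambda_distinct : injective lambda)
    (lambda_eigenvalues :
       forall a : R[i], eigenvalue Z a <-> exists l : 'I_A, a = lambda l) :
  forall eps : R, 0 < eps ->
  exists (N : nat) (kappa : R), [/\ (0 < N)%N, 0 < kappa &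
    forall (j k : 'I_z) (i : nat), (N < i)%N ->
      `|(Z ^+ i) j k| ^+ 2
        < (kappa * (spectral_radius Z + eps) ^+ (2 * i))%:C].
Proof.
move=> eps eps_gt0.
(* Square matrices form a ring only in size [n.+1]; size 0 contradicts [1 <= A <= z]. *)
case: z => [|n] in Z A_le_z lambda_eigenvalues *.
  by move: (leq_trans A_ge1 A_le_z).
have le_radius a : eigenvalue Z a -> `|a| <= (spectral_radius Z)%:C.
  by apply: (le_spectral_radius (lambda := lambda)) => b /lambda_eigenvalues.
have radius_ge0 : 0 <= (spectral_radius Z)%:C.
  have /le_radius : eigenvalue Z (lambda (Ordinal A_ge1)).
    by apply/lambda_eigenvalues; exists (Ordinal A_ge1).
  exact: le_trans.
set s := spectral_radius Z + eps.
have rs : (spectral_radius Z)%:C < s%:C by rewrite ltcR ltrDl.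
have s_gt0 : 0 < s%:C := le_lt_trans radius_ge0 rs.
have [roots charE] := closed_field_poly_normal (char_poly Z).
have bound (jk : 'I_n.+1 * 'I_n.+1) :
    exists K, forall i, `|(Z ^+ i) jk.1 jk.2| <= K * s%:C ^+ i.
  have [a a_roots||K KP] :=
      @annihilated_power_bound _ _ Z _ _ roots 1 jk.1 jk.2 rs.
  - apply: le_radius; rewrite eigenvalue_root_char charE rootZ; last first.
      by rewrite lead_coef_eq0 monic_neq0 ?char_poly_monic.
    by rewrite root_prod_XsubC.
  - rewrite mulr1; have := Cayley_Hamilton Z.
    by rewrite charE (monicP (char_poly_monic Z)) scale1r.
  - by exists K => i; rewrite -[Z ^+ i]mulr1.
have [K KP] := fin_all_exists bound.
have K_ge0 jk : 0 <= K jk.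
  by have := KP jk 0; rewrite [s%:C ^+ 0]expr0 mulr1; apply: le_trans.
(* One constant for all entries: the sum dominates each [K jk], and the added 1 makes the final
   inequality strict. *)
pose B := \sum_jk K jk + 1.
have B_gt0 : 0 < B by rewrite ltr_wpDl ?sumr_ge0.
have BE : (complex.Re B)%:C = B by rewrite RRe_real // gtr0_real.
(* The bound holds for every [i], so any positive [N] serves; [B] is squared because the entries
   are. *)
exists 1, (complex.Re B ^+ 2); split=> //.
  by rewrite exprn_gt0 // -ltcR BE.
move=> j k i _.
rewrite mulnC exprM -exprMn rmorphXn rmorphM rmorphXn /= BE.
rewrite ltr_pXn2r ?nnegrE ?mulr_ge0 ?exprn_ge0 ?(ltW B_gt0) ?(ltW s_gt0) //.
apply: le_lt_trans (KP (j, k) i) _.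
rewrite ltr_pM2r ?exprn_gt0 // /B (bigD1 (j, k)) //= -addrA ltrDl.
by rewrite ltr_wpDl ?sumr_ge0.
Qed.
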